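(* Let $\mathcal{AP}$ be the set of all anti-palindromic compositions (of all weights $n\ge 0$). Then $$\sum_{\sigma\in \mathcal{AP}}x^{|\sigma|}y^{\mathrm{parts}(\sigma)}=\frac{1 - x - x^2 + x^3 + x y - x^3 y}{1 - x - x^2 + x^3 - 2 x^3 y^2}.$$
   Context: A composition of $n\ge0$ is a finite sequence $\sigma=(\sigma_1,\dots,\sigma_\ell)$ of positive integers summing to $n$; $|\sigma|=n$ is its weight and $\mathrm{parts}(\sigma)=\ell$ (the empty composition is the composition of $0$ with $0$ parts). A composition $(\sigma_1,\dots,\sigma_\ell)$ is anti-palindromic if $\sigma_i\neq\sigma_{\ell+1-i}$ for all $i\in\{1,\dots,\ell\}$ with $i\neq(\ell+1)/2$. *)

(* Defs.v *)
From HB Require Import structures.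
From mathcomp Require Import all_boot all_order all_algebra.
From mathcomp Require Import boolp classical_sets functions cardinality fsbigop.

Set Implicit Arguments.
Unset Strict Implicit.
Unset Printing Implicit Defensive.

Import GRing.Theory.
Local Open Scope ring_scope.

(* The ring R[[X]] of formal power series. It is a record, and not an alias of
   nat -> R, since function types already carry the pointwise ring structure. *)
Record fps (R : Type) := Fps { fcoef : nat -> R }.

Lemma fpsP (R : Type) (f g : fps R) : fcoef f =1 fcoef g <-> f = g.
Proof.
split=> [|-> //]; case: f g => [f] [g] /= fg.
by congr Fps; apply/funext.
Qed.

HB.instance Definition _ (R : Type) := gen_eqMixin (fps R).
HB.instance Definition _ (R : Type) := gen_choiceMixin (fps R).

Definition fps_zero (R : zmodType) : fps R := Fps (fun=> 0).
Definition fps_opp (R : zmodType) (f : fps R) := Fps (fun n => - fcoef f n).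
Definition fps_add (R : zmodType) (f g : fps R) :=
  Fps (fun n => fcoef f n + fcoef g n).

Lemma fps_addA (R : zmodType) : associative (@fps_add R).
Proof. by move=> f g h; apply/fpsP => n /=; rewrite addrA. Qed.
Lemma fps_addC (R : zmodType) : commutative (@fps_add R).
Proof. by move=> f g; apply/fpsP => n /=; rewrite addrC. Qed.
Lemma fps_add0 (R : zmodType) : left_id (@fps_zero R) (@fps_add R).
Proof. by move=> f; apply/fpsP => n /=; rewrite add0r. Qed.
Lemma fps_addN (R : zmodType) :
  left_inverse (@fps_zero R) (@fps_opp R) (@fps_add R).
Proof. by move=> f; apply/fpsP => n /=; rewrite addNr. Qed.

HB.instance Definition _ (R : zmodType) := GRing.isZmodule.Build (fps R)
  (@fps_addA R) (@fps_addC R) (@fps_add0 R) (@fps_addN R).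

Definition fpsC (R : zmodType) (c : R) : fps R :=
  Fps (fun n => if n == 0%N then c else 0).
Definition fpsX (R : nzRingType) : fps R := Fps (fun n => (n == 1%N)%:R).

Definition fps_mul (R : comNzRingType) (f g : fps R) : fps R :=
  Fps (fun n => \sum_(i < n.+1) fcoef f i * fcoef g (n - i)%N).

Definition fps_trunc (R : comNzRingType) (N : nat) (f : fps R) : {poly R} :=
  \poly_(i < N.+1) fcoef f i.

Lemma coef_fps_trunc (R : comNzRingType) (N : nat) (f : fps R) (n : nat) :
  (n <= N)%N -> (fps_trunc N f)`_n = fcoef f n.
Proof. by move=> nN; rewrite coef_poly ltnS nN. Qed.

Lemma coef_fps_mul (R : comNzRingType) (N : nat) (f g : fps R) (n : nat) :
  (n <= N)%N ->
  fcoef (fps_mul f g) n = (fps_trunc N f * fps_trunc N g)`_n.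
Proof.
move=> nN; rewrite coefM; apply: eq_bigr => i _.
rewrite !coef_fps_trunc //; first by rewrite (leq_trans (leq_subr _ _)).
by rewrite (leq_trans _ nN) // -ltnS.
Qed.

Lemma fps_mulA (R : comNzRingType) : associative (@fps_mul R).
Proof.
move=> f g h; apply/fpsP => n.
transitivity (fps_trunc n f * (fps_trunc n g * fps_trunc n h))`_n.
  rewrite coefM; apply: eq_bigr => i _.
  rewrite coef_fps_trunc; last by rewrite -ltnS.
  by rewrite (@coef_fps_mul _ n) // leq_subr.
rewrite mulrA coefM; apply: eq_bigr => i _.
rewrite coef_fps_trunc; last by rewrite leq_subr.
by rewrite (@coef_fps_mul _ n) // -ltnS.
Qed.

Lemma fps_mulC (R : comNzRingType) : commutative (@fps_mul R).
Proof.
by move=> f g; apply/fpsP => n; rewrite !(@coef_fps_mul _ n) // mulrC.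
Qed.

Lemma fps_mul1 (R : comNzRingType) : left_id (@fpsC R 1) (@fps_mul R).
Proof.
move=> f; apply/fpsP => n /=; rewrite big_ord_recl /= mul1r subn0 big1 ?addr0 //.
by move=> i _; rewrite mul0r.
Qed.

Lemma fps_mulDl (R : comNzRingType) :
  left_distributive (@fps_mul R) (@fps_add R).
Proof.
move=> f g h; apply/fpsP => n /=; rewrite -big_split /=.
by apply: eq_bigr => i _; rewrite mulrDl.
Qed.

Lemma fps_1neq0 (R : comNzRingType) : @fpsC R 1 != 0.
Proof.
by apply/eqP => /fpsP /(_ 0%N) /= /eqP; rewrite oner_eq0.
Qed.

HB.instance Definition _ (R : comNzRingType) :=
  GRing.Zmodule_isComNzRing.Build (fps R)
    (@fps_mulA R) (@fps_mulC R) (@fps_mul1 R) (@fps_mulDl R) (@fps_1neq0 R).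

Lemma fcoefM (R : comNzRingType) (f g : fps R) (n : nat) :
  fcoef (f * g) n = \sum_(i < n.+1) fcoef f i * fcoef g (n - i)%N.
Proof. by []. Qed.

Definition fps_unit (R : comUnitRingType) : {pred fps R} :=
  fun f => fcoef f 0 \is a GRing.unit.

(* The first n coefficients g_0, ..., g_(n-1) of the inverse g of f, from
   g_m * f_0 = [m = 0] - \sum_(i < m) g_i * f_(m - i). *)
Fixpoint fps_inv_seq (R : comUnitRingType) (f : fps R) (n : nat) : seq R :=
  if n is m.+1 then
    let s := fps_inv_seq f m in
    rcons s (((m == 0%N)%:R - \sum_(i < m) s`_i * fcoef f (m - i)%N)
               / fcoef f 0)
  else [::].

Definition fps_inv (R : comUnitRingType) (f : fps R) : fps R :=
  if f \in @fps_unit R then Fps (fun n => (fps_inv_seq f n.+1)`_n) else f.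

Lemma size_fps_inv_seq (R : comUnitRingType) (f : fps R) (n : nat) :
  size (fps_inv_seq f n) = n.
Proof. by elim: n => //= n IHn; rewrite size_rcons IHn. Qed.

Lemma nth_fps_inv_seq (R : comUnitRingType) (f : fps R) (n i : nat) :
  (i < n)%N -> (fps_inv_seq f n)`_i = (fps_inv_seq f i.+1)`_i.
Proof.
elim: n => // n IHn; rewrite ltnS leq_eqVlt => /orP[/eqP -> //|lt_in].
by rewrite [in LHS]/= nth_rcons size_fps_inv_seq lt_in IHn.
Qed.

Lemma fps_mulVx (R : comUnitRingType) :
  {in @fps_unit R, left_inverse 1 (@fps_inv R) *%R}.
Proof.
move=> f Uf; rewrite /fps_inv Uf; apply/fpsP => n.
rewrite fcoefM big_ord_recr /= subnn nth_rcons size_fps_inv_seq ltnn eqxx.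
rewrite divrK //; under eq_bigr => i _ do rewrite -/(fps_inv_seq f i.+1).
rewrite [X in X + _](_ : _ = \sum_(i < n) (fps_inv_seq f n)`_i * fcoef f (n - i)%N).
  by rewrite addrC subrK; case: (n).
by apply: eq_bigr => i _; rewrite (nth_fps_inv_seq f (ltn_ord i)).
Qed.

Lemma fps_unitPl (R : comUnitRingType) (f g : fps R) :
  g * f = 1 -> @fps_unit R f.
Proof.
move=> /fpsP /(_ 0%N); rewrite fcoefM big_ord1 subnn /= => gf.
by apply/unitrPr; exists (fcoef g 0); rewrite mulrC.
Qed.

Lemma fps_inv_out (R : comUnitRingType) :
  {in [predC @fps_unit R], @fps_inv R =1 id}.
Proof. by move=> f /negPf nUf; rewrite /fps_inv; move: nUf => /= ->. Qed.

HB.instance Definition _ (R : comUnitRingType) :=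
  GRing.ComNzRing_hasMulInverse.Build (fps R)
    (@fps_mulVx R) (@fps_unitPl R) (@fps_inv_out R).

(* Z[[x, y]] is encoded as Z[[x]][[y]]. *)
Notation fps2 := (fps (fps int)).
Definition xvar : fps2 := fpsC (fpsX int).
Definition yvar : fps2 := fpsX (fps int).

Definition coef2 (F : fps2) (n k : nat) : int := fcoef (fcoef F k) n.

(* Sum of a family of bivariate series that is summable, i.e., for all n and k
   only finitely many members have a nonzero coefficient of x^n y^k: the
   coefficients are added up separately, as sums with finite support. *)
Definition fps2_sum (I : choiceType) (A : set I) (F : I -> fps2) : fps2 :=
  Fps (fun k => Fps (fun n => \sum_(i \in A) coef2 (F i) n k)).

Definition fps2_summable (I : choiceType) (A : set I) (F : I -> fps2) : Prop :=
  forall n k, finite_set [set i | A i /\ coef2 (F i) n k <> 0]%classic.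

Definition is_composition (s : seq nat) : Prop :=
  forall a, a \in s -> (0 < a)%N.
Definition weight (s : seq nat) : nat := sumn s.
Definition parts (s : seq nat) : nat := size s.

(* The i-th part, counted from 1. *)
Definition part (s : seq nat) (i : nat) : nat := nth 0%N s i.-1.

(* i <> (l + 1) / 2 is an inequation between rationals, hence 2 i <> l + 1. *)
Definition antipalindromic (s : seq nat) : Prop :=
  forall i, (1 <= i <= parts s)%N -> (2 * i)%N <> (parts s + 1)%N ->
    part s i <> part s (parts s + 1 - i).

Definition AP : set (seq nat) :=
  [set s | is_composition s /\ antipalindromic s]%classic.

Lemma fcoefXn (R : comNzRingType) (k n : nat) :
  fcoef (fpsX R ^+ k) n = (n == k)%:R.
Proof.
elim: k n => [|k IHk] n; first by rewrite expr0 /=; case: n.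
rewrite exprS fcoefM; case: n => [|n].
  by rewrite big_ord1 /= mul0r.
rewrite big_ord_recl /= mul0r add0r big_ord_recl /= mul1r IHk big1 ?addr0.
  by rewrite subSS subn0 eqSS.
by move=> i _; rewrite mul0r.
Qed.

Lemma fpsCX (R : comNzRingType) (c : R) (n : nat) :
  fpsC c ^+ n = fpsC (c ^+ n).
Proof.
elim: n => [|n IHn]; first by rewrite !expr0.
rewrite !exprS IHn; apply/fpsP => -[|m]; rewrite fcoefM ?big_ord1 //=.
by rewrite big_ord_recl /= mulr0 add0r big1 // => i _; rewrite mul0r.
Qed.

Lemma coef2_monomial (a b n k : nat) :
  coef2 (xvar ^+ a * yvar ^+ b) n k = ((n == a) && (k == b))%:R.
Proof.
rewrite /coef2 /xvar /yvar fpsCX fcoefM big_ord_recl big1 => [|i _]; last first.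
  by rewrite [fcoef (fpsC _) _]/= mul0r.
rewrite addr0 subn0 fcoefXn [fcoef (fpsC _) _]/=; case: (k == b).
  by rewrite mulr1 fcoefXn andbT.
by rewrite mulr0 andbF.
Qed.

Lemma AP_summable :
  fps2_summable AP (fun s => xvar ^+ weight s * yvar ^+ parts s).
Proof.
move=> n k; apply: (@sub_finite_set _ _
  ((fun t : k.-tuple 'I_n.+1 => map (@nat_of_ord _) t) @` [set: _])%classic);
  last exact/finite_image/finite_finset.
move=> s [_]; rewrite coef2_monomial.
have [/andP[/eqP nE /eqP kE] _|//] := boolP (_ && _).
have ltn a : a \in s -> (a < n.+1)%N.
  rewrite ltnS nE /weight; elim: s {nE kE} => //= b s IHs.
  rewrite inE => /orP[/eqP ->|/IHs h]; first exact: leq_addr.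
  exact: leq_trans h (leq_addl _ _).
have szt : size (map (@inord n) s) == k by rewrite size_map kE.
exists (Tuple szt) => //=; rewrite -map_comp -[RHS]map_id.
by apply/eq_in_map => a /ltn an /=; rewrite inordK.
Qed.

(* Main.v *)
From HB Require Import structures.
Require Import Defs.
From mathcomp Require Import all_boot all_order all_algebra.
From mathcomp Require Import classical_sets fsbigop.
From mathcomp Require Import ring zify.

(** Removing the first and the last part of an anti-palindromic composition
    with at least two parts leaves an anti-palindromic composition and a pair of
    distinct positive integers, and this is a bijection.  Let [G_k] be the series
    in [x] of the anti-palindromic compositions with [k] parts.  Then [G_0 = 1],
    [G_1 = x / (1 - x)] and [G_(k+2) = P * G_k], where
      [P = x^2 / (1 - x)^2 - x^2 / (1 - x^2) = 2 x^3 / ((1 - x)^2 (1 + x))]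
    enumerates the pairs of distinct positive integers by their sum.  To stay
    with finite sums, the coefficient of [x^n] is computed from the compositions
    with parts at most [N], for any [N >= n]. *)

Import GRing.Theory.
Local Open Scope ring_scope.

(** * Coefficients of formal power series *)

Lemma fpsC_is_zmod_morphism (R : zmodType) : zmod_morphism (@fpsC R).
Proof. by move=> a b; apply/fpsP => -[|n] //=; rewrite subr0. Qed.

HB.instance Definition _ (R : zmodType) :=
  GRing.isZmodMorphism.Build R (fps R) (@fpsC R) (@fpsC_is_zmod_morphism R).

Lemma fcoefD (R : zmodType) (f g : fps R) (n : nat) :
  fcoef (f + g) n = fcoef f n + fcoef g n.
Proof. by []. Qed.

Lemma fcoefN (R : zmodType) (f : fps R) (n : nat) :
  fcoef (- f) n = - fcoef f n.
Proof. by []. Qed.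

Lemma fcoef_fpsC_mul (R : comNzRingType) (c : R) (f : fps R) (n : nat) :
  fcoef (fpsC c * f) n = c * fcoef f n.
Proof.
rewrite fcoefM big_ord_recl /= subn0 big1 ?addr0 // => i _.
by rewrite mul0r.
Qed.

(** Together with additivity this makes [fpsC] a ring morphism, which carries polynomial expressions
    in [fpsX int] to the same expressions in [xvar]. *)
Lemma fpsC_is_monoid_morphism (R : comNzRingType) :
  monoid_morphism (@fpsC R).
Proof.
split=> // a b; apply/fpsP => n; rewrite fcoef_fpsC_mul /=.
by case: (n == 0%N); rewrite ?mulr0.
Qed.

HB.instance Definition _ (R : comNzRingType) :=
  GRing.isMonoidMorphism.Build R (fps R) (@fpsC R)
    (@fpsC_is_monoid_morphism R).

Lemma fcoef_Xn_mul (R : comNzRingType) (m : nat) (f : fps R) (n : nat) :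
  fcoef (fpsX R ^+ m * f) n = if (n < m)%N then 0 else fcoef f (n - m).
Proof.
rewrite fcoefM; have [nm|mn] := ltnP n m.
  rewrite big1 // => i _; rewrite fcoefXn.
  by case: eqP (ltn_ord i) => [->|]; [lia | rewrite mul0r].
have mn' : (m < n.+1)%N by [].
rewrite (bigD1 (Ordinal mn')) //= fcoefXn eqxx mul1r big1 ?addr0 // => i.
by rewrite -val_eqE /= fcoefXn => /negPf ->; rewrite mul0r.
Qed.

(** Allows a series to be replaced by a finite sum inside a product when a single coefficient is
    computed. *)
Lemma fcoef_mul_eq_trunc (R : comNzRingType) (d f g : fps R) (n : nat) :
    (forall m, (m <= n)%N -> fcoef f m = fcoef g m) ->
  fcoef (d * f) n = fcoef (d * g) n.
Proof.
by move=> fg; rewrite !fcoefM; apply: eq_bigr => i _; rewrite fg ?leq_subr.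
Qed.

(** * Removing the outer parts of an anti-palindromic composition *)

Lemma AP_nil : AP [::].
Proof. by split=> // i /=; rewrite /parts /=; lia. Qed.

Lemma AP_seq1 (a : nat) : AP [:: a] <-> (0 < a)%N.
Proof.
split=> [[pos _]|a0]; first by apply: pos; rewrite inE.
split=> [b|i]; first by rewrite inE => /eqP ->.
by rewrite /parts /=; lia.
Qed.

(** Reflection of positions commutes with the shift by one: position [i.+1] of the long sequence
    carries the condition at position [i] of [s], and middle corresponds to middle. The first and
    the last position both give [a != b]. *)
Lemma AP_cons_rcons (a b : nat) (s : seq nat) :
  AP (a :: rcons s b) <-> [/\ AP s, (0 < a)%N, (0 < b)%N & a != b].
Proof.
have partS i : (1 <= i <= size s)%N -> part (a :: rcons s b) i.+1 = part s i.
  by case: i => // i /andP[_ lt_is]; rewrite /part /= nth_rcons lt_is.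
have partb : part (a :: rcons s b) (size s).+2 = b.
  by rewrite /part /= nth_rcons ltnn eqxx.
have szE : parts (a :: rcons s b) = (size s).+2 by rewrite /parts /= size_rcons.
split=> [[pos anti]|[[pos anti] a0 b0 ab]]; split.
- split=> [c cs|i i_s iNmid].
    by apply: pos; rewrite inE mem_rcons inE cs !orbT.
  rewrite /parts in i_s iNmid *.
  have := anti i.+1; rewrite szE partS //.
  have -> : ((size s).+2 + 1 - i.+1 = (size s + 1 - i).+1)%N by lia.
  by rewrite partS; [apply; lia | lia].
- by apply: pos; rewrite inE eqxx.
- by apply: pos; rewrite inE mem_rcons inE eqxx orbT.
- apply/eqP; have := anti 1%N; rewrite szE.
  have -> : ((size s).+2 + 1 - 1 = (size s).+2)%N by lia.
  by rewrite partb; apply; lia.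
- by move=> c; rewrite inE mem_rcons inE => /or3P[/eqP ->|/eqP ->|/pos].
- rewrite /antipalindromic szE => i i_s iNmid.
  have [i1|iN1] := eqVneq i 1%N.
    rewrite i1; have -> : ((size s).+2 + 1 - 1 = (size s).+2)%N by lia.
    by rewrite partb; apply/eqP.
  have [i2|iN2] := eqVneq i (size s).+2.
    rewrite i2; have -> : ((size s).+2 + 1 - (size s).+2 = 1)%N by lia.
    by rewrite partb; apply/eqP; rewrite eq_sym.
  have -> : i = i.-1.+1 by lia.
  have -> : ((size s).+2 + 1 - i.-1.+1 = (size s + 1 - i.-1).+1)%N by lia.
  rewrite !partS; [|lia..].
  by apply: anti; rewrite /parts; lia.
Qed.

(** * Listing the compositions with bounded parts *)

Definition distinct_pairs (N : nat) : seq (nat * nat) :=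
  [seq p <- [seq (a, b) | a <- iota 1 N, b <- iota 1 N] | p.1 != p.2].

Lemma mem_distinct_pairs (N a b : nat) :
  ((a, b) \in distinct_pairs N) =
  [&& a != b, (0 < a <= N)%N & (0 < b <= N)%N].
Proof.
rewrite mem_filter /=; congr (_ && _).
apply/allpairsP/idP => [[[c d] [/=]]|/andP[aN bN]].
  by rewrite !mem_iota => ? ? [-> ->]; lia.
by exists (a, b); split; rewrite //= mem_iota; lia.
Qed.

Lemma distinct_pairs_uniq (N : nat) : uniq (distinct_pairs N).
Proof.
by rewrite filter_uniq // allpairs_uniq ?iota_uniq // => -[a b] [c d] _ _.
Qed.

Definition surround (s : seq nat) (p : nat * nat) : seq nat :=
  p.1 :: rcons s p.2.

Fixpoint AP_enum (N k : nat) : seq (seq nat) :=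
  match k with
  | 0 => [:: [::]]
  | 1 => [seq [:: a] | a <- iota 1 N]
  | k'.+2 => [seq surround s p | s <- AP_enum N k', p <- distinct_pairs N]
  end.

Lemma nat_ind2 (P : nat -> Prop) :
  P 0%N -> P 1%N -> (forall k, P k -> P k.+2) -> forall k, P k.
Proof.
move=> P0 P1 PSS k; suff: P k /\ P k.+1 by case.
by elim: k => // k [Pk PSk]; split=> //; apply: PSS.
Qed.

Lemma AP_enum_uniq (N k : nat) : uniq (AP_enum N k).
Proof.
elim/nat_ind2: k => [//||k IHk] /=.
  by rewrite map_inj_uniq ?iota_uniq // => a b [].
rewrite allpairs_uniq ?distinct_pairs_uniq // => -[s [a b]] [t [c d]] _ _ /=.
by case=> -> /rcons_inj[-> ->].
Qed.

Lemma AP_enumP (N k : nat) (s : seq nat) :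
  s \in AP_enum N k <->
  [/\ AP s, size s = k & forall a, a \in s -> (a <= N)%N].
Proof.
elim/nat_ind2: k s => [s|s|k IHk s] /=.
- rewrite inE; split=> [/eqP ->|[_ /size0nil -> //]].
  by split=> //; exact: AP_nil.
- split=> [/mapP[a]|[]].
    rewrite mem_iota => aN ->; split=> //; first by apply/AP_seq1; lia.
    by move=> b; rewrite inE => /eqP ->; lia.
  case: s => [|a [|]] // /AP_seq1 a0 _ aN; apply: map_f.
  by rewrite mem_iota; have := aN a; rewrite inE eqxx => /(_ isT); lia.
- split=> [/allpairsP[[t [a b]] /= [/IHk[APt szt tN] + ->]]|[]].
    rewrite mem_distinct_pairs => /and3P[ab aN bN].
    split; first by apply/AP_cons_rcons; split=> //=; lia.
      by rewrite /surround /= size_rcons szt.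
    move=> c; rewrite inE mem_rcons inE => /or3P[/eqP ->|/eqP ->|/tN //].
      by case/andP: aN.
    by case/andP: bN.
  case: s => // a s; case/lastP: s => // t b /AP_cons_rcons[APt a0 b0 ab].
  rewrite /= size_rcons => -[szt] leN.
  apply/allpairsP; exists (t, (a, b)); split=> //=.
    by apply/IHk; split=> // c ct; apply: leN; rewrite inE mem_rcons inE ct !orbT.
  rewrite mem_distinct_pairs ab a0 b0 /=.
  by rewrite !leN // !(inE, mem_rcons) eqxx ?orbT.
Qed.

Lemma le_sumn (s : seq nat) (a : nat) : a \in s -> (a <= sumn s)%N.
Proof.
by elim: s => //= b s IHs; rewrite inE => /orP[/eqP ->|/IHs]; lia.
Qed.

(** * The series for a fixed number of parts and its truncations *)

Definition AP_series : fps2 :=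
  fps2_sum AP (fun s => xvar ^+ weight s * yvar ^+ parts s).

Definition AP_trunc (N k : nat) : fps int :=
  \sum_(s <- AP_enum N k) fpsX int ^+ weight s.

Lemma fcoef_sum (R : zmodType) (I : Type) (r : seq I) (F : I -> fps R) n :
  fcoef (\sum_(i <- r) F i) n = \sum_(i <- r) fcoef (F i) n.
Proof. by elim/big_rec2: _ => // i a f _ <-. Qed.

(** A part is at most the weight, so every composition of [n] with [k] parts is in the list when
    [n <= N]; those outside it contribute zero. *)
Lemma fcoef_AP_series (N k n : nat) : (n <= N)%N ->
  fcoef (fcoef AP_series k) n = fcoef (AP_trunc N k) n.
Proof.
move=> nN; rewrite /AP_trunc fcoef_sum /=.
transitivity (\sum_(s \in [set` AP_enum N k]%classic)
    coef2 (xvar ^+ weight s * yvar ^+ parts s) n k).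
  apply/esym/fsbig_widen => [s /= /AP_enumP[]//|s [/= APs sNE]].
  rewrite coef2_monomial; case: andP => // -[/eqP nE /eqP kE].
  case: sNE; apply/AP_enumP; split=> // a /le_sumn aw.
  by rewrite (leq_trans aw) // -/(weight s) -nE.
rewrite -fsbig_seq ?AP_enum_uniq //; apply: eq_big_seq => s /AP_enumP[_ szs _].
by rewrite coef2_monomial fcoefXn /parts szs eqxx andbT.
Qed.

Lemma AP_trunc0 (N : nat) : AP_trunc N 0 = 1.
Proof. by rewrite /AP_trunc big_seq1. Qed.

Lemma AP_trunc1 (N : nat) : AP_trunc N 1 = \sum_(a <- iota 1 N) fpsX int ^+ a.
Proof.
by rewrite /AP_trunc big_map; apply: eq_bigr => a _; rewrite /weight /= addn0.
Qed.

Lemma AP_truncSS (N k : nat) :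
  AP_trunc N k.+2 =
  (\sum_(p <- distinct_pairs N) fpsX int ^+ (p.1 + p.2)) * AP_trunc N k.
Proof.
rewrite /AP_trunc /= big_allpairs_dep mulr_sumr; apply: eq_bigr => s _.
rewrite mulr_suml; apply: eq_bigr => p _; rewrite -exprD; congr (_ ^+ _).
by rewrite /weight /surround /= sumn_rcons; lia.
Qed.

(** * The series of the pairs of distinct integers *)

Lemma geometric_sum_iota1 (R : comNzRingType) (z : R) (N : nat) :
  (1 - z) * \sum_(a <- iota 1 N) z ^+ a = z - z * z ^+ N.
Proof.
elim: N => [|N IHN]; first by rewrite big_nil expr0; ring.
by rewrite -(addn1 N) iotaD big_cat big_seq1 mulrDr IHN !exprD /=; ring.
Qed.

(** The square runs over all pairs, and the diagonal pairs [(a, a)] make up the subtracted sum. *)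
Lemma sum_distinct_pairs (R : comNzRingType) (z : R) (N : nat) :
  \sum_(p <- distinct_pairs N) z ^+ (p.1 + p.2) =
  (\sum_(a <- iota 1 N) z ^+ a) ^+ 2 - \sum_(a <- iota 1 N) (z ^+ 2) ^+ a.
Proof.
rewrite big_filter; apply/eqP; rewrite eq_sym subr_eq; apply/eqP.
rewrite expr2 big_distrlr /=.
under [LHS]eq_bigr do under eq_bigr do rewrite -exprD.
rewrite -(big_allpairs (F := fun p => z ^+ (p.1 + p.2))).
rewrite (bigID (fun p => p.1 != p.2)) /=; congr (_ + _).
rewrite big_mkcond big_allpairs; apply: eq_big_seq => a aN /=.
rewrite (bigD1_seq a) ?iota_uniq //= eqxx /= big1 ?addr0.
  by rewrite -exprM mul2n addnn.
by move=> b; rewrite eq_sym => ->.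
Qed.

(** This is [(1 - X) ^+ 2 * (1 + X)], the common denominator of the two fractions in [P]. *)
Definition pair_denom : fps int := 1 - fpsX int - fpsX int ^+ 2 + fpsX int ^+ 3.

Lemma denom_mul_distinct_pairs (N : nat) :
  exists e, pair_denom * \sum_(p <- distinct_pairs N) fpsX int ^+ (p.1 + p.2) =
    2 * fpsX int ^+ 3 + fpsX int ^+ N * e.
Proof.
set X := fpsX int.
have := geometric_sum_iota1 _ X N; have := geometric_sum_iota1 _ (X ^+ 2) N.
rewrite sum_distinct_pairs exprAC.
set S1 := \sum_(a <- _) X ^+ a; set S2 := \sum_(a <- _) (X ^+ 2) ^+ a.
set Y := X ^+ N => S2E S1E.
(* The witness is read off from [(1 + X) * (X - X * Y) ^+ 2 - (1 - X) * (X ^+ 2 - X ^+ 2 * Y ^+ 2)]: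
   the terms free of [Y] add up to [2 * X ^+ 3], and [Y] is factored out of the others. *)
exists (X ^+ 2 * (1 + X) * (Y - 2) + X ^+ 2 * (1 - X) * Y).
transitivity ((1 + X) * ((1 - X) * S1) ^+ 2 - (1 - X) * ((1 - X ^+ 2) * S2)).
  by rewrite /pair_denom -/X; ring.
by rewrite S1E S2E; ring.
Qed.

(** * The recurrence in the number of parts *)

Lemma AP_series0 : fcoef AP_series 0 = 1.
Proof. by apply/fpsP => n; rewrite (fcoef_AP_series n) // AP_trunc0. Qed.

Lemma AP_series1 : pair_denom * fcoef AP_series 1 = fpsX int - fpsX int ^+ 3.
Proof.
apply/fpsP => n.
(* The bound is [n.+1] and not [n], so that the remainder, a multiple of [X ^+ n.+1], does not reach
   the coefficient [n]. *)
rewrite (fcoef_mul_eq_trunc _ _ _ (AP_trunc n.+1 1)); last first.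
  by move=> m mn; rewrite (fcoef_AP_series n.+1) // leqW.
set X := fpsX int.
have -> : pair_denom = (1 - X ^+ 2) * (1 - X) by rewrite /pair_denom -/X; ring.
rewrite AP_trunc1 -mulrA geometric_sum_iota1.
have -> : (1 - X ^+ 2) * (X - X * X ^+ n.+1)
    = (X - X ^+ 3) + X ^+ n.+1 * (X ^+ 3 - X) by ring.
by rewrite fcoefD fcoef_Xn_mul ltnSn addr0.
Qed.

Lemma AP_seriesSS (k : nat) :
  pair_denom * fcoef AP_series k.+2 = 2 * fpsX int ^+ 3 * fcoef AP_series k.
Proof.
apply/fpsP => n.
have truncE j m : (m <= n)%N ->
    fcoef (fcoef AP_series j) m = fcoef (AP_trunc n.+1 j) m.
  by move=> mn; rewrite (fcoef_AP_series n.+1) // leqW.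
rewrite (fcoef_mul_eq_trunc _ _ _ _ _ (truncE k.+2)).
rewrite (fcoef_mul_eq_trunc _ _ _ _ _ (truncE k)).
rewrite AP_truncSS mulrA; have [e ->] := denom_mul_distinct_pairs n.+1.
by rewrite mulrDl fcoefD -[X in _ + fcoef X _]mulrA fcoef_Xn_mul ltnSn addr0.
Qed.

Theorem theorem2p8 :
  let x := xvar in
  let y := yvar in
  fps2_sum AP (fun s => x ^+ weight s * y ^+ parts s) =
    (1 - x - x ^+ 2 + x ^+ 3 + x * y - x ^+ 3 * y) /
    (1 - x - x ^+ 2 + x ^+ 3 - 2 * x ^+ 3 * y ^+ 2).
Proof.
move=> x y; rewrite -/AP_series.
set X := fpsX int.
have DE : fpsC pair_denom = 1 - x - x ^+ 2 + x ^+ 3.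
  by rewrite /pair_denom !(rmorphB, rmorphD, rmorphXn, rmorph1).
have X3E : fpsC (2 * X ^+ 3) = 2 * x ^+ 3.
  by rewrite rmorphM rmorphXn rmorph_nat.
have XE : fpsC (X - X ^+ 3) = x - x ^+ 3 by rewrite rmorphB rmorphXn.
set den := (X in _ / X); set num := (X in X / _).
have denE : den = fpsC pair_denom - y ^+ 2 * fpsC (2 * X ^+ 3).
  by rewrite DE X3E /den; ring.
(* The exponent 1 is written out for [fcoef_Xn_mul] to apply. *)
have numE : num = fpsC pair_denom + y ^+ 1 * fpsC (X - X ^+ 3).
  by rewrite DE XE /num; ring.
(* Invertibility is decided by the constant coefficient, first in [y], where it is [pair_denom],
   then in [x], where it is 1. *)
have den_unit : den \is a GRing.unit.
  have -> : (den \is a GRing.unit) = (fcoef den 0 \is a GRing.unit) by [].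
  rewrite denE fcoefD fcoefN fcoef_Xn_mul subr0.
  have -> : (pair_denom \is a GRing.unit) =
      (fcoef pair_denom 0 \is a GRing.unit) by [].
  by rewrite /pair_denom !fcoefD !fcoefN !fcoefXn.
(* After clearing the denominator, the coefficients of [y ^+ k] give the two initial values for [k]
   equal to 0 and 1, and the recurrence from 2 on. *)
apply: (canRL (mulrK den_unit)); apply/fpsP => k.
rewrite mulrC denE numE mulrBl -mulrA.
rewrite !fcoefD fcoefN fcoef_Xn_mul !fcoef_fpsC_mul fcoef_Xn_mul.
case: k => [|[|k]].
- by rewrite AP_series0 mulr1 subr0.
- by rewrite AP_series1 subr0 [RHS]add0r.
- by rewrite AP_seriesSS !subSS !subn0 subrr [RHS]addr0.
Qed.
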